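(* Let $p$ be an odd prime, $L=\mathbb F_{p^m}$, $\sigma=p^s$ with $0<s<m$, and let $l,R\in L^*$ with $-l\notin L^{\sigma-1}$ and $R\notin L^{\sigma+1}$. Then the presemifield $C(p,m,s,l,R)$ is isotopic to a commutative semifield if and only if $l^{\sigma+1}R^{\sigma-1}\in L^{\sigma^2-1}$.
   Context: A finite presemifield $(F,+,* )$ is a finite abelian group $(F,+)$ with a multiplication satisfying both distributive laws and such that $x*y=0$ implies $x=0$ or $y=0$; a semifield is a presemifield with a multiplicative identity. Two presemifields $(F,+,* )$, $(F',+,*')$ are isotopic if there are additive group isomorphisms $A,B,C\colon F\to F'$ with $A(x)*'B(y)=C(x*y)$ for all $x,y$. For an integer $k\ge0$, $L^k=\{x^k:x\in L\}$. For $l,R\in L^*$ with $-l\notin L^{\sigma-1}$, $R\notin L^{\sigma+1}$, the presemifield $C(p,m,s,l,R)$ is the additive group $L^2$ with multiplication $$(a,b)*(c,d)=\big(ac^{\sigma}+Rbd^{\sigma}+l(a^{\sigma}c+Rb^{\sigma}d),\ ad+bc\big).$$ *)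

(* Defs.v *)
From HB Require Import structures.
From mathcomp Require Import all_boot all_order all_fingroup all_algebra all_field.
From mathcomp Require Import ring.

Set Implicit Arguments.
Unset Strict Implicit.
Unset Printing Implicit Defensive.

Import GRing.Theory.
Local Open Scope ring_scope.

(* The library has the nmodule and finite structures on a product, but not
   their join. *)
HB.instance Definition _ (U V : finZmodType) := Finite.on (U * V)%type.

Definition is_presemifield (F : finZmodType) (mul : F -> F -> F) : Prop :=
  [/\ left_distributive mul +%R, right_distributive mul +%R
    & forall x y, mul x y = 0 -> x = 0 \/ y = 0].

Definition is_semifield (F : finZmodType) (mul : F -> F -> F) : Prop :=
  is_presemifield mul /\ exists e, left_id e mul /\ right_id e mul.

Definition isotopic (F F' : finZmodType)
    (mul : F -> F -> F) (mul' : F' -> F' -> F') : Prop :=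
  exists A B C : {additive F -> F'},
    [/\ bijective A, bijective B, bijective C
      & forall x y, mul' (A x) (B y) = C (mul x y)].

(* L^k; the element 0 of L is included among the bases. *)
Definition kpowers (L : finFieldType) (k : nat) : {set L} :=
  [set x ^+ k | x : L].

(* The multiplication of C(p,m,s,l,R), with sigma = p ^ s; the exponent m only
   enters through the cardinality of L. *)
Definition Cmul (L : finFieldType) (p s : nat) (l R : L)
    (u v : (L * L)%type) : (L * L)%type :=
  let sigma := (p ^ s)%N in
  let: (a, b) := u in
  let: (c, d) := v in
  (a * c ^+ sigma + R * b * d ^+ sigma
     + l * (a ^+ sigma * c + R * b ^+ sigma * d),
   a * d + b * c).

Lemma Cmul_presemifield (L : finFieldType) (p m s : nat) (l R : L) :
  prime p -> #|L| = (p ^ m)%N ->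
  - l \notin kpowers L (p ^ s - 1) -> R \notin kpowers L (p ^ s + 1) ->
  is_presemifield (Cmul p s l R).
Proof.
move=> p_pr cardL hl hR; have pL := card_finPcharP cardL p_pr.
have sig_gt0 : (0 < p ^ s)%N by rewrite expn_gt0 prime_gt0.
move: hl hR; rewrite /Cmul; set sg := (p ^ s)%N in sig_gt0 * => hl hR.
have sD (x y : L) : (x + y) ^+ sg = x ^+ sg + y ^+ sg.
  by apply: exprDn_pchar; rewrite pnatX pnatE ?pL.
have s0 : (0 : L) ^+ sg = 0 by rewrite expr0n gtn_eqF.
have sN (x : L) : (- x) ^+ sg = - x ^+ sg.
  by apply/eqP; rewrite -addr_eq0 -sD addNr s0.
split.
- by move=> [a b] [c d] [e f]; congr (_, _) => /=; rewrite ?sD; ring.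
- by move=> [a b] [c d] [e f]; congr (_, _) => /=; rewrite ?sD; ring.
move=> [a b] [c d] /= [eq1 eq2].
have [/eqP [-> ->]|cd0] := boolP ((c, d) == (0, 0)); first by right.
left; have [t at_ bt] : exists2 t, a = t * c & b = - t * d.
  have [d0|dn0] := eqVneq d 0.
    move: cd0; rewrite {}d0 in eq2 *; rewrite xpair_eqE eqxx andbT => cn0.
    exists (a / c); first by rewrite divfK.
    apply/eqP; move/eqP: eq2.
    by rewrite !mulr0 add0r mulf_eq0 (negPf cn0) orbF.
  exists (- (b / d)); last by rewrite opprK divfK.
  apply: (mulIf dn0); rewrite mulrAC mulNr divfK // mulNr.
  by apply/eqP; rewrite -addr_eq0 eq2.
suff t0 : t = 0 by rewrite at_ bt t0 oppr0 !mul0r.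
apply/eqP; apply: contraT => tn0.
have : (t + l * t ^+ sg) * (c ^+ (sg + 1) - R * d ^+ (sg + 1)) = 0.
  rewrite -eq1 at_ bt !exprMn sN !exprD !expr1; ring.
move/eqP; rewrite mulf_eq0 => /orP[h|].
  case/negP: hl; apply/imsetP; exists t^-1 => //.
  have tE : t ^+ sg = t ^+ (sg - 1) * t by rewrite -exprSr subn1 prednK.
  have tsn0 : t ^+ (sg - 1) != 0 by rewrite expf_neq0.
  rewrite exprVn; apply: (mulIf tsn0); rewrite mulVf // mulNr.
  apply: (mulIf tn0); rewrite mul1r mulNr -mulrA -tE.
  by apply/eqP; rewrite eq_sym -addr_eq0.
rewrite subr_eq0 => /eqP cR.
have dn0 : d != 0.
  apply: contraNneq cd0 => d0; move: cR.
  rewrite d0 expr0n addn1 mulr0 => /eqP.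
  by rewrite expf_eq0 /= => /eqP ->.
case/negP: hR; apply/imsetP; exists (c / d) => //.
by rewrite expr_div_n cR mulfK // expf_neq0.
Qed.

(* Main.v *)
From HB Require Import structures.
Require Import Defs.
From mathcomp Require Import all_boot all_order all_fingroup all_algebra all_field.
From mathcomp Require Import ring.

Import GRing.Theory.
Local Open Scope ring_scope.

(** The proof turns isotopy into a question of linear algebra.  If [*'] is
    commutative and [A x *' B y = C (x * y)], then the additive bijection
    [T = A^-1 B] satisfies [T x * y = T y * x], because [C (T x * y)] is
    [B x *' B y].  Conversely such a [T] makes [T x * y] a commutative
    presemifield product, and Kaplansky's trick isotopes it into a semifield
    without losing commutativity ([commutative_isotopeP]).

    For [C(p,m,s,l,R)] write [S] for sigma.  The second coordinate [a d + b c]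
    of the product is a nondegenerate symmetric [L]-bilinear form, and this
    forces [T (c, d) = (al c + be d, ga c + al d)] ([symmetrizer_form]).  As [S]
    does not fix [L] pointwise, [c] and [c^S] are independent and comparing
    coefficients in the first coordinate gives
      [al = l al^S],  [R ga = l be^S],  [be = l R ga^S]
    ([Cmul_symmetrizer_coef]).  The last two equations amount to
    [l^(S+1) R^(S-1) ga^(S^2-1) = 1] when [ga] is nonzero, which is the
    criterion; read backwards, they produce [T (c, d) = (be d, ga c)]
    ([Cmul_symmetrizerP]).

    There remains [ga = 0].  Then [be = 0], [al] is nonzero and [l] is the
    [(S-1)]-st power of [al^-1].  Since [-l] is not an [(S-1)]-st power, neither
    is [-1], and this makes [L^(S-1)] and [L^(S^2-1)] coincide
    ([kpowers_sqr_sub1]), so that the criterion holds automatically. *)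

(** * Commutative isotopes and symmetrizers *)

Definition symmetrizer {F : finZmodType} (mul : F -> F -> F) (T : F -> F) :=
  forall x y, mul (T x) y = mul (T y) x.

Lemma additive_of_morph {U V : zmodType} {f : U -> V} :
  {morph f : x y / x + y >-> x + y} -> exists g : {additive U -> V}, g =1 f.
Proof.
move=> fD.
have fB : zmod_morphism f.
  by move=> x y; apply/eqP; rewrite eq_sym subr_eq -fD subrK.
pose g : {additive U -> V} := HB.pack f (GRing.isZmodMorphism.Build U V f fB).
by exists g.
Qed.

Lemma inv_morphD {U V : zmodType} {f : {additive U -> V}} {g : V -> U} :
  cancel f g -> cancel g f -> {morph g : x y / x + y >-> x + y}.
Proof. by move=> fK gK x y; apply: (can_inj fK); rewrite raddfD !gK. Qed.

(** In the converse direction [M x = T x * e] is a bijection because there are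
    no zero divisors; transporting the commutative product [T x * y] along [M]
    turns [M e] into a two-sided identity. *)
Lemma commutative_isotopeP {F : finZmodType} {mul : F -> F -> F} {e : F} :
    is_presemifield mul -> e != 0 ->
  (exists (F' : finZmodType) (mul' : F' -> F' -> F'),
      [/\ is_semifield mul', commutative mul' & isotopic mul mul'])
  <-> (exists2 T : {additive F -> F}, injective T & symmetrizer mul T).
Proof.
move=> [mulDl mulDr mul_eq0] e_neq0; split.
  move=> [F' [mul' [_ mul'C [A [B [C [[A' AK A'K] [B' BK B'K] [C' CK _] ABC]]]]]]].
  have TD : {morph A' \o B : x y / x + y >-> x + y}.
    by move=> x y /=; rewrite raddfD (inv_morphD AK A'K).
  have [T TE] := additive_of_morph TD; exists T.
    by move=> x y; rewrite !TE => /(can_inj A'K)/(can_inj BK).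
  by move=> x y; apply: (can_inj CK); rewrite -!ABC !TE /= !A'K mul'C.
move=> [T T_inj Tsym].
pose M x := mul (T x) e.
have MD : {morph M : x y / x + y >-> x + y}.
  by move=> x y; rewrite /M raddfD mulDl.
have [N NE] := additive_of_morph MD.
have N_inj : injective N.
  apply: raddf_inj => x; rewrite NE => /mul_eq0[|e0]; last first.
    by rewrite e0 eqxx in e_neq0.
  by rewrite -[RHS](raddf0 T) => /T_inj.
have [N' NK N'K] := injF_bij N_inj.
have [T' TK T'K] := injF_bij T_inj.
have N'D := inv_morphD NK N'K.
have T'D := inv_morphD TK T'K.
pose mul' u v := mul (T (N' u)) (N' v).
have mul'C : commutative mul' by move=> u v; apply: Tsym.
have mul'Ne : left_id (N e) mul'.
  by move=> v; rewrite /mul' NK Tsym -[LHS]/(M _) -NE N'K.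
exists F, mul'; split => //.
  split; last by exists (N e); split=> // v; rewrite mul'C.
  split=> [x y z|x y z|x y].
  - by rewrite /mul' N'D raddfD mulDl.
  - by rewrite /mul' N'D mulDr.
  - case/mul_eq0 => [TN'x0|N'y0]; last by right; rewrite -(N'K y) N'y0 raddf0.
    have N'x0 : N' x = 0 by apply: T_inj; rewrite TN'x0 raddf0.
    by left; rewrite -(N'K x) N'x0 raddf0.
have AD : {morph N \o T' : x y / x + y >-> x + y}.
  by move=> x y /=; rewrite T'D raddfD.
have [A AE] := additive_of_morph AD.
have idD : {morph @id F : x y / x + y >-> x + y} by [].
have [C CE] := additive_of_morph idD.
exists A, N, C; split.
- apply: injF_bij => x y; rewrite !AE => /N_inj.
  exact: (can_inj T'K).
- exact: injF_bij.
- by apply: injF_bij => x y; rewrite !CE.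
- by move=> x y; rewrite AE CE /mul' /= !NK T'K.
Qed.

(** * The Frobenius power [S = p ^ s] on a finite field *)

Section Frobenius.

Variables (L : finFieldType) (p m s : nat).
Hypotheses (p_pr : prime p) (cardL : #|L| = (p ^ m)%N).
Local Notation S := (p ^ s)%N.

Lemma frobenius_gt0 : (0 < S)%N.
Proof. by rewrite expn_gt0 prime_gt0. Qed.

Lemma frobeniusD (x y : L) : (x + y) ^+ S = x ^+ S + y ^+ S.
Proof.
apply: exprDn_pchar.
by rewrite pnatX pnatE ?(card_finPcharP cardL p_pr).
Qed.

Lemma frobenius0 : (0 : L) ^+ S = 0.
Proof. by rewrite expr0n gtn_eqF // frobenius_gt0. Qed.

Lemma frobeniusN (x : L) : (- x) ^+ S = - x ^+ S.
Proof.
by apply/eqP; rewrite -addr_eq0 -frobeniusD addNr frobenius0.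
Qed.

Lemma frobenius_sub1 (x : L) : x ^+ (S - 1) * x = x ^+ S.
Proof. by rewrite -exprSr subn1 prednK // frobenius_gt0. Qed.

Lemma sqr_sub1E : (S ^ 2 - 1 = (S - 1) * (S + 1))%N.
Proof. by rewrite -subn_sqr exp1n. Qed.

Hypothesis s_gt0 : (0 < s)%N.

Lemma sub1_gt0 : (0 < S - 1)%N.
Proof. by rewrite subn_gt0 -{1}(expn0 p) ltn_exp2l ?prime_gt1. Qed.

Lemma sqr_sub1_gt0 : (0 < S ^ 2 - 1)%N.
Proof. by rewrite sqr_sub1E muln_gt0 sub1_gt0 addn1. Qed.

Lemma frobenius_nontrivial :
  (s < m)%N -> exists c : L, c ^+ S != c.
Proof.
move=> s_lt_m; apply/existsP; apply: contraT.
rewrite negb_exists => /forallP fixL.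
have S_gt1 : (1 < S)%N by rewrite -{1}(expn0 p) ltn_exp2l ?prime_gt1.
have sizeP : size ('X^S - 'X : {poly L}) = S.+1.
  by rewrite size_polyDl ?size_polyXn // size_polyN size_polyX.
have := @max_poly_roots _ ('X^S - 'X : {poly L}) (enum L).
rewrite -size_poly_eq0 sizeP -cardE cardL enum_uniq ltnS => /(_ isT) lt_card.
have /lt_card/(_ isT) : all (root ('X^S - 'X : {poly L})) (enum L).
  apply/allP => c _; rewrite rootE !hornerE subr_eq0.
  by have := fixL c; rewrite negbK.
by rewrite leq_exp2l ?prime_gt1 // leqNgt s_lt_m.
Qed.

(** The image of [L^(S-1)] under the [(S+1)]-st power map is [L^(S^2-1)], and it
    lies in the finite set [L^(S-1)], so it is enough that the map is injective
    there.  On quotients of nonzero elements this is a kernel computation: if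
    [y = z^(S-1)] and [y^(S+1) = 1], then [z^(S^2) = z], so [w = z^S - z]
    satisfies [w^S = - w].  As [-1] is not an [(S-1)]-st power, [w = 0], that is
    [y = 1]. *)
Lemma kpowers_sqr_sub1 :
  -1 \notin kpowers L (S - 1) -> kpowers L (S ^ 2 - 1) = kpowers L (S - 1).
Proof.
move=> N1.
have ker (z : L) : z != 0 -> z ^+ (S ^ 2 - 1) = 1 -> z ^+ (S - 1) = 1.
  move=> z0 z1.
  have zSS : (z ^+ S) ^+ S = z.
    rewrite -exprM -[(S * S)%N](@subnK 1) ?muln_gt0 ?frobenius_gt0 //.
    by rewrite mulnn exprD z1 mul1r.
  have wS : (z ^+ S - z) ^+ S = - (z ^+ S - z).
    by rewrite frobeniusD frobeniusN zSS opprB.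
  have [w0|w0] := eqVneq (z ^+ S - z) 0.
    apply: (mulIf z0); rewrite frobenius_sub1 mul1r.
    by apply/eqP; rewrite -subr_eq0 w0.
  case/negP: N1; apply/imsetP; exists (z ^+ S - z) => //.
  by apply: (mulIf w0); rewrite frobenius_sub1 wS mulN1r.
have inj : {in kpowers L (S - 1) &, injective (fun y : L => y ^+ (S + 1))}.
  move=> _ _ /imsetP[u _ ->] /imsetP[v _ ->]; rewrite -!exprM -sqr_sub1E => uv.
  have [v0|v0] := eqVneq v 0.
    move: uv; rewrite v0 !expr0n !gtn_eqF ?sqr_sub1_gt0 ?sub1_gt0 //= => /eqP.
    by rewrite expf_eq0 => /andP[_ /eqP->]; rewrite expr0n gtn_eqF ?sub1_gt0.
  have u0 : u != 0.
    move: (expf_neq0 (S ^ 2 - 1) v0); rewrite -uv.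
    by rewrite expf_eq0 sqr_sub1_gt0.
  have vn0 k : v ^+ k != 0 by rewrite expf_neq0.
  apply: (divIf (vn0 (S - 1)%N)); rewrite divff // -expr_div_n.
  apply: ker; first by rewrite mulf_neq0 ?invr_eq0.
  by rewrite expr_div_n uv divff.
suff im : [set y ^+ (S + 1) | y in kpowers L (S - 1)] = kpowers L (S - 1).
  rewrite -[RHS]im /kpowers -imset_comp; apply: eq_imset => x /=.
  by rewrite sqr_sub1E exprM.
apply/eqP; rewrite eqEcard (card_in_imset inj) leqnn andbT.
apply/subsetP => _ /imsetP[_ /imsetP[z _ ->] ->].
by apply/imsetP; exists (z ^+ (S + 1)); rewrite // -!exprM mulnC.
Qed.

(** * Symmetrizers of [C(p,m,s,l,R)] *)

(** Test against the basis vectors [(1, 0)] and [(0, 1)]: each of them reads off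
    one coordinate of [T x] as an [L]-linear function of [x]. *)
Lemma symmetrizer_form {l R : L} {T : (L * L)%type -> (L * L)%type} :
    symmetrizer (Cmul p s l R) T ->
  exists al be ga,
    forall c d, T (c, d) = (al * c + be * d, ga * c + al * d).
Proof.
move=> Tsym.
have sym2 a b c d : (T (a, b)).1 * d + (T (a, b)).2 * c
                  = (T (c, d)).1 * b + (T (c, d)).2 * a.
  have := Tsym (a, b) (c, d); rewrite /Cmul.
  by case: (T (a, b)) => ? ?; case: (T (c, d)) => ? ? [].
have diag : (T (0, 1)).2 = (T (1, 0)).1.
  by have := sym2 0 1 1 0; rewrite !(mulr0, mulr1, add0r, addr0).
exists (T (1, 0)).1, (T (0, 1)).1, (T (1, 0)).2 => c d.
rewrite [LHS]surjective_pairing; congr (_, _).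
  by have := sym2 c d 0 1; rewrite diag mulr1 mulr0 addr0 addrC.
by have := sym2 c d 1 0; rewrite mulr1 mulr0 add0r addrC.
Qed.

(** Pairs [(c, 0), (1, 0)] isolate [al].  Pairs [(x, 0), (0, 1)] give
    [u x = v x^S] for all [x], with [u = R ga - l be^S] and [v = be - l R ga^S];
    [x = 1] yields [u = v], and an [x] that [S] moves then yields [u = 0]. *)
Lemma Cmul_symmetrizer_coef {l R al be ga : L} :
    (s < m)%N ->
    symmetrizer (Cmul p s l R)
      (fun x => (al * x.1 + be * x.2, ga * x.1 + al * x.2)) ->
  [/\ al = l * al ^+ S, R * ga = l * be ^+ S & be = l * R * ga ^+ S].
Proof.
move=> s_lt_m Tsym; have [c cS] := frobenius_nontrivial s_lt_m.
have indep (u : L) : u * (c - c ^+ S) = 0 -> u = 0.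
  by move/eqP; rewrite mulf_eq0 subr_eq0 [c == _]eq_sym (negPf cS) orbF => /eqP.
have alE : al = l * al ^+ S.
  apply/eqP; rewrite -subr_eq0; apply/eqP/indep.
  have [] := Tsym (c, 0) (1, 0).
  rewrite /= !(mulr0, mulr1, addr0, expr1n, frobenius0) exprMn => /eqP.
  by rewrite -subr_eq0 => /eqP <- _; ring.
have mixed (x : L) :
    (R * ga - l * be ^+ S) * x = (be - l * R * ga ^+ S) * x ^+ S.
  have [] := Tsym (x, 0) (0, 1).
  rewrite /= !(mulr0, mulr1, addr0, add0r, expr1n, frobenius0) !exprMn => /eqP.
  rewrite -subr_eq0 => /eqP E _; apply/eqP.
  by rewrite -subr_eq0 -E; apply/eqP; ring.
have eqc : R * ga - l * be ^+ S = be - l * R * ga ^+ S.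
  by have := mixed 1; rewrite expr1n !mulr1.
have gaE : R * ga - l * be ^+ S = 0.
  by apply: indep; rewrite mulrBr mixed -eqc subrr.
by split=> //; apply/eqP; rewrite -subr_eq0 -?eqc gaE.
Qed.

(** Substituting [be = l R ga^S] into [l be^S = R ga] turns it into
    [l^(S+1) R^(S-1) ga^(S^2-1) = 1], up to the factor [R ga]. *)
Lemma coef_elimination (l R ga : L) :
  l * (l * R * ga ^+ S) ^+ S
  = l ^+ (S + 1) * R ^+ (S - 1) * ga ^+ (S ^ 2 - 1) * (R * ga).
Proof.
have gaSS : ga ^+ (S ^ 2 - 1) * ga = ga ^+ (S * S).
  by rewrite -exprSr subn1 mulnn prednK // expn_gt0 frobenius_gt0.
rewrite !exprMn -exprM -gaSS -[R ^+ S]frobenius_sub1 exprD.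
by ring.
Qed.

(** When [ga] is nonzero, [ga^-1] is the base of the required [(S^2-1)]-st power.
    When [ga = 0], [T] is multiplication by [al] and [l = (al^-1)^(S-1)], so
    [l^(S+1)] is always an [(S^2-1)]-st power and only [R^(S-1)] matters. *)
Lemma Cmul_symmetrizerP {l R : L} :
    (s < m)%N -> l != 0 -> R != 0 ->
    - l \notin kpowers L (S - 1) ->
  (exists2 T : {additive (L * L)%type -> (L * L)%type},
      injective T & symmetrizer (Cmul p s l R) T)
  <-> l ^+ (S + 1) * R ^+ (S - 1) \in kpowers L (S ^ 2 - 1).
Proof.
move=> s_lt_m l0 R0 hl; split.
  move=> [T T_inj Tsym]; have [al [be [ga TE]]] := symmetrizer_form Tsym.
  have [|alE gaE beE] := @Cmul_symmetrizer_coef l R al be ga s_lt_m.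
    by move=> [a b] [c d]; have := Tsym (a, b) (c, d); rewrite !TE.
  have [ga0|ga0] := eqVneq ga 0; last first.
    apply/imsetP; exists ga^-1 => //.
    have gan0 : ga ^+ (S ^ 2 - 1) != 0 by rewrite expf_neq0.
    rewrite exprVn; apply: (mulIf gan0); rewrite mulVf //.
    apply: (mulIf (mulf_neq0 R0 ga0)).
    by rewrite mul1r -coef_elimination -beE gaE.
  have be0 : be = 0 by rewrite beE ga0 frobenius0 mulr0.
  have al0 : al != 0.
    apply/eqP => al0; have : ((1 : L), (0 : L)) = (0, 0).
      by apply: T_inj; rewrite !TE al0 be0 ga0 !mul0r.
    by case=> /eqP; rewrite oner_eq0.
  have lE : l = al^-1 ^+ (S - 1).
    have an0 : al ^+ (S - 1) != 0 by rewrite expf_neq0.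
    rewrite exprVn; apply: (mulIf an0); rewrite mulVf //; apply: (mulIf al0).
    by rewrite -mulrA frobenius_sub1 mul1r -alE.
  have N1 : -1 \notin kpowers L (S - 1).
    apply: contra hl => /imsetP[z _ zE]; apply/imsetP; exists (z / al) => //.
    by rewrite exprMn -zE -lE mulN1r.
  have : R ^+ (S - 1) \in kpowers L (S ^ 2 - 1).
    by rewrite kpowers_sqr_sub1 //; apply/imsetP; exists R.
  case/imsetP=> x _ ->; apply/imsetP; exists (al^-1 * x) => //.
  by rewrite exprMn lE -exprM -sqr_sub1E.
case/imsetP=> z _ zE.
have z0 : z != 0.
  apply: contraTneq (_ : l ^+ (S + 1) * R ^+ (S - 1) != 0) => [z0|].
    by rewrite zE z0 expr0n gtn_eqF ?sqr_sub1_gt0 ?eqxx.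
  by rewrite mulf_neq0 ?expf_neq0.
(* [be] is kept opaque so that [exprMn] does not expand [be ^+ S] below. *)
pose ga := z^-1; have [be beE] : exists be, be = l * R * ga ^+ S by eexists.
have ga0 : ga != 0 by rewrite invr_eq0.
have be0 : be != 0 by rewrite beE !mulf_neq0 ?expf_neq0.
have gaE : R * ga = l * be ^+ S.
  rewrite beE coef_elimination zE -exprMn.
  by rewrite /ga mulfV // expr1n mul1r.
pose T0 (x : (L * L)%type) := (be * x.2, ga * x.1).
have T0D : {morph T0 : x y / x + y >-> x + y}.
  by move=> [a b] [c d]; congr (_, _); rewrite /= mulrDr.
have [T TE] := additive_of_morph T0D; exists T.
  by move=> [a b] [c d]; rewrite !TE => -[/(mulfI be0)-> /(mulfI ga0)->].
move=> [a b] [c d]; rewrite !TE /T0 /Cmul /=; congr (_, _); last by ring.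
rewrite !exprMn [R * (ga * a)]mulrA [R * (ga * c)]mulrA gaE.
by move: (be ^+ S) => beS; rewrite beE; ring.
Qed.

End Frobenius.

Theorem theorem7p1 (p m s : nat) (L : finFieldType) (l R : L)
    (hp : prime p) (hp_odd : odd p) (hL : #|L| = (p ^ m)%N)
    (hs0 : (0 < s)%N) (hsm : (s < m)%N)
    (hl0 : l != 0) (hR0 : R != 0)
    (hl : - l \notin kpowers L (p ^ s - 1))
    (hR : R \notin kpowers L (p ^ s + 1)) :
  (exists (F : finZmodType) (mul : F -> F -> F),
      [/\ is_semifield mul, commutative mul & isotopic (Cmul p s l R) mul])
  <-> l ^+ (p ^ s + 1) * R ^+ (p ^ s - 1) \in kpowers L ((p ^ s) ^ 2 - 1).
Proof.
have e_neq0 : ((1, 0) : (L * L)%type) != 0.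
  by rewrite xpair_eqE oner_eq0.
have pres := Cmul_presemifield hp hL hl hR.
apply: iff_trans (commutative_isotopeP pres e_neq0) _.
exact: (Cmul_symmetrizerP L p m s hp hL hs0 hsm hl0 hR0 hl).
Qed.
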